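(* Let $v^A$ and $v^{\mathrm{CVaR}}$ denote the optimal values of ALSO-X and of the CVaR approximation, respectively, for the chance constrained program $$v^*=\min_{x\in\mathcal X}\{c^\top x:\ \mathbb P\{\tilde\xi: g(x,\tilde\xi)\le 0\}\ge 1-\varepsilon\}.$$ Then, under Assumptions A1 and A2, $v^A\le v^{\mathrm{CVaR}}$.
   Context: Setting. $\tilde\xi$ is a random vector on a probability space $(\Omega,\mathcal F,\mathbb P)$ with support $\Xi\subseteq\mathbb R^m$; $\varepsilon\in(0,1)$ is the risk level; $c\in\mathbb R^n$; $\mathcal X\subseteq\mathbb R^n$. Constraints on random quantities are understood to hold almost surely; $[I]=\{1,\dots,I\}$. Assumptions. (A1) $g(x,\xi)=\max_{i\in[I]}g_i(x,\xi)$ with $g_i:\mathbb R^n\times\Xi\to\mathbb R$, where each $g_i(x,\xi)$ is convex and lower semicontinuous in $x$ for almost every $\xi\in\Xi$. (A2) $\mathcal X$ is nonempty, closed, convex, and contained in a closed pointed convex cone $\mathcal C$. Also in force throughout is the standing assumption (A3): the feasible region of the chance constrained program is nonempty and $c\in\mathrm{int}(\mathcal C^* )\cup\{0\}$, where $\mathcal C^*$ is the dual cone of $\mathcal C$. ALSO-X is the bilevel problem $$v^A=\min_t\ t\quad\text{s.t.}\quad (x^*,s^*(\cdot))\in\operatorname*{argmin}_{x\in\mathcal X,\ s(\cdot)\ge0}\{\mathbb E[s(\tilde\xi)]:\ g(x,\tilde\xi)\le s(\tilde\xi),\ c^\top x\le t\},\qquad \mathbb P\{\tilde\xi: s^*(\tilde\xi)=0\}\ge1-\varepsilon,$$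 where $s(\cdot):\Xi\to\mathbb R$ is a functional variable. The CVaR approximation is $$v^{\mathrm{CVaR}}=\min_{x\in\mathcal X}\Big\{c^\top x:\ \min_{\beta\le 0}\big\{\beta+\tfrac1\varepsilon\mathbb E[(g(x,\tilde\xi)-\beta)_+]\big\}\le 0\Big\},\qquad (r)_+=\max\{r,0\}.$$ Equivalently, in bilevel form, $v^{\mathrm{CVaR}}=\min_t t$ subject to $(x^*,s^*(\cdot),\beta^* )\in\operatorname{argmin}_{x\in\mathcal X,\beta\le0,s(\cdot)}\{\mathbb E[s(\tilde\xi)]-(1-\varepsilon)\beta:\ g(x,\tilde\xi)\le s(\tilde\xi),\ s(\tilde\xi)\ge\beta,\ c^\top x\le t\}$ and $\mathbb E[s^*(\tilde\xi)]-(1-\varepsilon)\beta^*\le0$.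
   Formalization: When c = 0 it is additionally assumed that the lower-level problem of ALSO-X has a minimizer whenever it is feasible with finite value; otherwise the argmin can be empty, giving v^A = +∞ while v^CVaR = 0. Each g_i(x,·) is taken measurable, as E and P require. *)

(* Defs.v *)
From HB Require Import structures.
From mathcomp Require Import all_boot all_order all_algebra.
From mathcomp Require Import all_classical all_reals all_analysis.

Set Implicit Arguments.
Unset Strict Implicit.
Unset Printing Implicit Defensive.

Import Order.TTheory GRing.Theory Num.Theory.
Import numFieldNormedType.Exports.

Local Open Scope classical_set_scope.
Local Open Scope ring_scope.

(* 'rV[R]_m with its Borel sigma-algebra. *)
Definition borelRn (R : realType) (m : nat) :=
  g_sigma_algebraType (@open 'rV[R]_m).

Section Euclidean.
Context {R : realType} {n : nat}.

Definition dotp (x y : 'rV[R]_n) : R := \sum_(j < n) x 0 j * y 0 j.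

Definition dual_cone (C : set 'rV[R]_n) : set 'rV[R]_n :=
  [set y | forall x, C x -> 0 <= dotp y x].

Definition closed_pointed_convex_cone (C : set 'rV[R]_n) : Prop :=
  [/\ closed C,
      convex_set C,
      C 0 /\ (forall (a : R) x, 0 <= a -> C x -> C (a *: x)) &
      forall x, C x -> C (- x) -> x = 0].

End Euclidean.

Section ChanceConstraint.
Context {d : measure_display} {T : measurableType d} {R : realType}.
Context (P : probability T R) {m : nat} (xi : {RV P >-> borelRn R m}).

(* The support of a random vector: the smallest closed set of probability 1. *)
Definition is_support (Xi : set 'rV[R]_m) : Prop :=
  [/\ closed Xi,
      P (xi @^-1` Xi) = 1%E &
      forall F : set 'rV[R]_m, closed F -> P (xi @^-1` F) = 1%E -> Xi `<=` F].

Context (Xi : set 'rV[R]_m).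

(* A function on Xi is represented by a function on 'rV[R]_m whose values
   outside Xi are never used; hence Pr, Exp and almost_surely only look at the
   outcomes w with xi w \in Xi, which have total probability 1 when Xi is the
   support of xi. *)
Definition Pr (A : set 'rV[R]_m) : \bar R := P (xi @^-1` (Xi `&` A)).

Definition Exp (h : 'rV[R]_m -> R) : \bar R :=
  (\int[P]_(w in xi @^-1` Xi) (h (xi w))%:E)%E.

Definition almost_surely (Q : 'rV[R]_m -> Prop) : Prop :=
  {ae P, forall w, Xi (xi w) -> Q (xi w)}.

Definition gmax {n k : nat} (g : 'I_k.+1 -> 'rV[R]_n -> 'rV[R]_m -> R)
    (x : 'rV[R]_n) (z : 'rV[R]_m) : R :=
  \big[Num.max/g ord0 x z]_(i < k.+1) g i x z.

Context {n : nat} (eps : R) (c : 'rV[R]_n) (X : set 'rV[R]_n).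
Context (G : 'rV[R]_n -> 'rV[R]_m -> R).

Definition ccp_feasible : set 'rV[R]_n :=
  [set x | X x /\ ((1 - eps)%:E <= Pr [set z | (G x z <= 0)%R])%E].

Definition lower_feasible (t : R) (x : 'rV[R]_n) (s : 'rV[R]_m -> R) : Prop :=
  [/\ X x,
      measurable_fun (Xi : set (borelRn R m)) s,
      almost_surely (fun z => 0 <= s z),
      almost_surely (fun z => G x z <= s z) &
      dotp c x <= t].

(* Usual convention: a problem whose value is +oo has no minimizer. *)
Definition lower_argmin (t : R) (x : 'rV[R]_n) (s : 'rV[R]_m -> R) : Prop :=
  [/\ lower_feasible t x s,
      (Exp s < +oo)%E &
      forall x' s', lower_feasible t x' s' -> (Exp s <= Exp s')%E].

Definition lower_attained (t : R) : Prop :=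
  (exists x s, lower_feasible t x s /\ (Exp s < +oo)%E) ->
  exists x s, lower_argmin t x s.

(* Optimistic bilevel convention: some lower-level minimizer (x, s) satisfies
   the upper-level chance constraint. *)
Definition alsox_feasible : set R :=
  [set t | exists x s, lower_argmin t x s /\
     ((1 - eps)%:E <= Pr [set z | s z = 0%R])%E].

(* Optimal values live in \bar R; an infeasible problem has value +oo. *)
Definition alsox_value : \bar R := ereal_inf [set t%:E | t in alsox_feasible].

Definition cvar_term (x : 'rV[R]_n) (b : R) : \bar R :=
  (b%:E + (eps^-1)%:E * Exp (fun z => Num.max (G x z - b) 0)%R)%E.

Definition cvar_feasible : set 'rV[R]_n :=
  [set x | X x /\
     (ereal_inf [set cvar_term x b | b in [set b : R | (b <= 0)%R]] <= 0)%E].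

Definition cvar_value : \bar R :=
  ereal_inf [set (dotp c x)%:E | x in cvar_feasible].

End ChanceConstraint.

(* Main.v *)
(* Let x be feasible for the CVaR problem and t = c.x. For any lower-level
   minimizer at t, its x-part y minimizes E[G(y)_+] over X and {c.y <= t}: such
   a y exists by compactness of this set and Fatou's lemma when c is interior to
   the dual cone. If P(G(y) > 0) > eps, pick eta > 0 with
   p := P(G(y) >= eta) > eps. By convexity, minimality of y against a small step
   towards x gives E[G(y)_+] <= E[(G(x) - b)_+] + b p for every b <= 0, whereas
   the CVaR constraint gives, for every e > 0, some b <= 0 with
   E[(G(x) - b)_+] <= eps (e - b). Hence
   eta p <= E[G(y)_+] <= eps e + b (p - eps) <= eps e, absurd for e = eta. *)

Require Import Defs.
From HB Require Import structures.
From mathcomp Require Import all_boot all_order all_algebra.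
From mathcomp Require Import all_classical all_reals all_analysis.
From mathcomp Require Import measurable_realfun ring lra.

Set Implicit Arguments.
Unset Strict Implicit.
Unset Printing Implicit Defensive.

Import Order.TTheory GRing.Theory Num.Theory.
Import numFieldNormedType.Exports.

Local Open Scope classical_set_scope.
Local Open Scope ring_scope.

(** * Coercivity of the linear objective and compactness of its sublevel sets *)

Lemma dotpDr (R : realType) (n : nat) (c x y : 'rV[R]_n) :
  dotp c (x + y) = dotp c x + dotp c y.
Proof.
by rewrite /dotp -big_split; apply: eq_bigr => j _ /=; rewrite mxE mulrDr.
Qed.

Lemma dotpZr (R : realType) (n : nat) (c x : 'rV[R]_n) (a : R) :
  dotp c (a *: x) = a * dotp c x.
Proof.
by rewrite /dotp mulr_sumr; apply: eq_bigr => j _ /=; rewrite mxE mulrCA.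
Qed.

Lemma dotpC (R : realType) (n : nat) (x y : 'rV[R]_n) : dotp x y = dotp y x.
Proof. by apply: eq_bigr => j _; rewrite mulrC. Qed.

Lemma continuous_dotp (R : realType) (n : nat) (c : 'rV[R]_n) :
  continuous (dotp c).
Proof.
have cf j : continuous (fun x : 'rV[R]_n => c 0 j * x 0 j).
  by move=> x; apply: continuousM; [exact: cst_continuous|exact: coord_continuous].
have addc : continuous (fun z : R * R => z.1 + z.2) by exact: (@add_continuous R^o).
by apply: (continuous_big addc) => j _; exact: cf.
Qed.

Lemma dotp_delta (R : realType) (n : nat) (x : 'rV[R]_n) (j : 'I_n) :
  dotp x (delta_mx 0 j) = x 0 j.
Proof.
rewrite /dotp (bigD1 j)//= mxE !eqxx mulr1 big1 ?addr0// => i ij.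
by rewrite mxE (negbTE ij) andbF mulr0.
Qed.

(** An interior point [c] stays in the dual cone when any one of its coordinates moves by [e / 2]
    either way. Pairing both perturbations with [x] gives [e / 2 * |x_j| <= dotp c x] for every [j],
    and the norm here is the sup norm, attained at some coordinate. *)
Lemma interior_dual_cone_coercive (R : realType) (n : nat) (C : set 'rV[R]_n)
    (c : 'rV[R]_n) : interior (dual_cone C) c ->
  exists2 r : R, 0 < r & forall x, C x -> r * `|x| <= dotp c x.
Proof.
rewrite /interior => /nbhs_ballP[e /= e0 ballC].
exists (e / 2); first by rewrite divr_gt0.
have cone a : `|a| <= e / 2 -> forall j x, C x -> 0 <= dotp c x + a * x 0 j.
  move=> ae j x Cx.
  have /(_ x Cx) : dual_cone C (c + a *: delta_mx 0 j).
    apply: ballC; rewrite mx_norm_ball /ball_ /= opprD addNKr normrN.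
    rewrite (@le_lt_trans _ _ (e / 2))//; last by rewrite ltr_pdivrMr// ltr_pMr// ltr1n.
    rewrite normrZ (le_trans _ ae)// ler_piMr//.
    have [->|d0] := eqVneq (delta_mx 0 j : 'rV[R]_n) 0; first by rewrite normr0.
    have [i] : exists i, mx_norm (delta_mx 0 j : 'rV[R]_n) =
        `|(delta_mx 0 j : 'rV[R]_n) i.1 i.2|.
      by apply: mx_norm_neq0; rewrite -[mx_norm _]/(`|delta_mx 0 j|) normr_eq0.
    rewrite -[mx_norm _]/(`|delta_mx 0 j|) => ->.
    by rewrite mxE; case: (_ && _); rewrite ?normr0 ?normr1.
  by rewrite dotpC dotpDr dotpZr dotp_delta dotpC.
move=> x Cx; have e2 : 0 <= e / 2 by rewrite divr_ge0// ltW.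
have [->|x0] := eqVneq x 0.
  by rewrite normr0 mulr0 /dotp big1// => j _; rewrite mxE mulr0.
have [[i j] xij] : exists i, mx_norm x = `|x i.1 i.2|.
  by apply: mx_norm_neq0; rewrite -[mx_norm _]/(`|x|) normr_eq0.
rewrite [`|x|]xij /= (ord1 i).
have h1 := cone (e / 2); have h2 := cone (- (e / 2)).
rewrite normrN ger0_norm// in h1 h2.
have {}h1 := h1 (lexx _) j x Cx; have {}h2 := h2 (lexx _) j x Cx.
have [_|_] := ger0P (x 0 j); lra.
Qed.

(** Coercivity bounds the norm by [t / r] on the sublevel set, so closedness suffices in finite
    dimension. *)
Lemma compact_sublevel (R : realType) (n : nat) (X C : set 'rV[R]_n)
    (c : 'rV[R]_n) (t : R) : closed X -> X `<=` C -> interior (dual_cone C) c ->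
  compact (X `&` [set x | dotp c x <= t]).
Proof.
move=> Xcl XC /interior_dual_cone_coercive[r r0 rC].
apply: bounded_closed_compact.
  exists (t / r); split; first by rewrite num_real.
  move=> M /ltW tM x [/XC Cx /= cxt]; apply: le_trans tM.
  by rewrite ler_pdivlMr// mulrC (le_trans _ cxt)// rC.
apply: closedI => //.
apply: (@closed_comp _ _ (dotp c) [set y | y <= t]).
  by move=> x _; apply: continuous_dotp.
exact: closed_le.
Qed.

(** * Lower limits, and the direct method for integrals of lower semicontinuous integrands *)

Lemma limn_einfE (R : realType) (u : (\bar R)^nat) :
  limn_einf u = ereal_sup (range (einfs u)).
Proof. by rewrite limn_einf_lim; apply/cvg_lim => //; exact: cvg_einfs_sup. Qed.

Lemma limn_einf_ge (R : realType) (u : (\bar R)^nat) (l : \bar R) :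
  (\forall n \near \oo, (l <= u n)%E) -> (l <= limn_einf u)%E.
Proof.
move=> [N _ lu]; rewrite limn_einfE.
apply: (@le_trans _ _ (einfs u N)); last by apply: ereal_sup_ubound; exists N.
by apply: le_ereal_inf_tmp => _ [k /= Nk] <-; exact: lu.
Qed.

Lemma limn_einf_le (R : realType) (u : (\bar R)^nat) (l : \bar R) :
  (forall e : R, 0 < e -> \forall n \near \oo, (u n <= l + e%:E)%E) ->
  (limn_einf u <= l)%E.
Proof.
move=> ul; rewrite limn_einfE; apply: ge_ereal_sup => _ [n _ <-].
apply/lee_addgt0Pr => e /ul[N _ uN].
apply: (@le_trans _ _ (u (maxn n N))); last by apply: uN => /=; exact: leq_maxr.
by apply: ereal_inf_lbound; exists (maxn n N) => //=; exact: leq_maxl.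
Qed.

Lemma lower_semicontinuous_limn_einf (R : realType) (V : topologicalType)
    (f : V -> R) (x : V) (y : V^nat) :
  lower_semicontinuous (fun v => (f v)%:E) -> y @ \oo --> x ->
  ((f x)%:E <= limn_einf (fun j => (f (y j))%:E))%E.
Proof.
move=> lscf yx; apply/lee_subgt0Pr => e e0; apply: limn_einf_ge.
have [|U /yx Ux fU] := lscf x (f x - e); first by rewrite lte_fin gtrBl.
by near=> j; rewrite -EFinB ltW//; apply: fU; near: j.
Unshelve. all: by end_near. Qed.

Lemma measurable_fun_limn_einf d (T : measurableType d) (R : realType)
    (D : set T) (f : (T -> \bar R)^nat) :
  (forall n, measurable_fun D (f n)) ->
  measurable_fun D (fun x => limn_einf (f ^~ x)).
Proof.
move=> mf; rewrite /limn_einf; apply: measurableT_comp => //.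
by apply: measurable_fun_limn_esup => n; exact: measurableT_comp.
Qed.

(** Direct method: a minimizing sequence in [K] clusters at some [x], and semicontinuity followed by
    Fatou's lemma bounds the integral at [x] by the infimum [l]. *)
Lemma integral_lsc_attains_min d (T : measurableType d) (R : realType)
    (mu : measure T R) (D : set T) (V : pseudoMetricType R) (K : set V)
    (f : V -> T -> R) : measurable D -> compact K -> K !=set0 ->
  (forall x w, 0 <= f x w) -> (forall x, measurable_fun D (f x)) ->
  {ae mu, forall w, D w -> lower_semicontinuous (fun x => (f x w)%:E)} ->
  exists2 x, K x & forall y, K y ->
    (\int[mu]_(w in D) (f x w)%:E <= \int[mu]_(w in D) (f y w)%:E)%E.
Proof.
move=> mD cK [x0 Kx0] f0 mf lscf.
pose F x := (\int[mu]_(w in D) (f x w)%:E)%E.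
have F0 x : (0 <= F x)%E by apply: integral_ge0 => w _; rewrite lee_fin.
have mfE x : measurable_fun D (EFin \o f x) by exact/measurable_EFinP.
pose l := ereal_inf (F @` K).
have lF y : K y -> (l <= F y)%E by move=> Ky; apply: ereal_inf_lbound; exists y.
(* An infinite infimum makes every point a minimizer; otherwise [l] is finite and can be approached
   within [1 / (n + 1)]. *)
have [loo|loo] := eqVneq l +oo%E.
  by exists x0 => // y /lF; rewrite loo leye_eq => /eqP Fy; rewrite -/(F y) Fy leey.
have lfin : l \is a fin_num.
  rewrite ge0_fin_numE ?ltey//.
  by apply: le_ereal_inf_tmp => _ [y _ <-].
have e_gt0 n : 0 < n.+1%:R^-1 :> R by rewrite invr_gt0.
have /choice[u uP] n : exists x, K x /\ (F x < l + n.+1%:R^-1%:E)%E.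
  by have [_ [x Kx <-] ?] := lb_ereal_inf_adherent (e_gt0 n) lfin; exists x.
have [x [Kx xu]] : exists x, (K `&` cluster (u @ \oo)) x.
  by apply: cK; exists 0%N => // n _; exact: (uP n).1.
(* This replaces the extraction of a subsequence: [y n] is some [u k] in the ball of radius
   [1 / (n + 1)] around [x]. Taking [k >= n] keeps its value below [l + 1 / (n + 1)]. *)
have /choice[y yP] n : exists z,
    [/\ K z, (F z < l + n.+1%:R^-1%:E)%E & ball x n.+1%:R^-1 z].
  have [|_ [[k /= nk <-] xuk]] := xu [set u k | k in [set k | (n <= k)%N]]
      (ball x n.+1%:R^-1) _ (nbhsx_ballx _ _ (e_gt0 n)).
    by exists n => // k /= nk; exists k.
  exists (u k); split=> //; first exact: (uP k).1.
  apply: (lt_le_trans (uP k).2); rewrite leeD2l// lee_fin lef_pV2 ?posrE//.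
  by rewrite ler_nat.
have yx : y @ \oo --> x.
  apply/cvg_ballP => e e0; near=> n; have [_ _] := yP n.
  by apply: le_ball; apply: ltW; near: n; exact: near_infty_natSinv_lt (PosNum e0).
exists x => // z Kz; apply: le_trans (lF _ Kz).
apply: (@le_trans _ _ (\int[mu]_(w in D) limn_einf (fun n => (f (y n) w)%:E))%E).
  have lim0 w : (0 <= limn_einf (fun n => (f (y n) w)%:E))%E.
    by apply: limn_einf_ge; exists 0%N => // n _ /=; rewrite lee_fin.
  apply: ae_ge0_le_integral => //; first by move=> w _; rewrite lee_fin.
    exact: mfE.
    exact: (measurable_fun_limn_einf (fun n => mfE (y n))).
  apply: filterS lscf => w /[apply] lscw.
  exact: (lower_semicontinuous_limn_einf lscw yx).
apply: le_trans (fatou mu mD (fun n => mfE (y n)) _) _.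
  by move=> n w _; rewrite lee_fin.
apply: limn_einf_le => e e0; near=> n; have [_ /ltW Fl _] := yP n.
apply: (le_trans Fl); rewrite leeD2l// lee_fin ltW//.
by near: n; exact: near_infty_natSinv_lt (PosNum e0).
Unshelve. all: by end_near. Qed.

(** * The pointwise maximum of the constraint functions *)

Section GMax.
Context {R : realType} {n m k : nat}.
Implicit Types (g : 'I_k.+1 -> 'rV[R]_n -> 'rV[R]_m -> R).

Lemma le_gmax g x z i : g i x z <= gmax g x z.
Proof. exact: (le_bigmax _ (fun i => g i x z)). Qed.

Lemma gmax_gtP g x z (a : R) :
  (a < gmax g x z) <-> (exists i, a < g i x z).
Proof.
split => [|[i agi]]; last exact: lt_le_trans agi (le_gmax _ _ _ i).
by move/bigmax_gtP => [a0|[i _ ai]]; [exists ord0|exists i].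
Qed.

Lemma measurable_gmax g (A : set 'rV[R]_m) x :
  (forall i, measurable_fun (A : set (borelRn R m)) (g i x)) ->
  measurable_fun (A : set (borelRn R m)) (gmax g x).
Proof.
move=> mg; rewrite /gmax; elim: (index_enum _) => [|i r IH].
  by under eq_fun do rewrite big_nil; exact: mg.
by under eq_fun do rewrite big_cons; exact: measurable_maxr.
Qed.

(** A strict lower bound on the maximum is witnessed by a single [g i] or by the constant 0, and the
    neighbourhood for that witness serves for the maximum. *)
Lemma lower_semicontinuous_gmax_pos g z :
  (forall i, lower_semicontinuous (fun x => (g i x z)%:E)) ->
  lower_semicontinuous (fun x => (Num.max (gmax g x z) 0)%:E).
Proof.
move=> lscg x a; rewrite lte_fin lt_max => /orP[/gmax_gtP[i agi]|a0].
  have [V xV Va] := lscg i x a agi; exists V => // y /Va agy.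
  by rewrite lte_fin lt_max; apply/orP; left; apply/gmax_gtP; exists i.
by exists setT => [|y _]; [exact: filterT|rewrite lte_fin lt_max a0 orbT].
Qed.

Lemma gmax_convex g z :
  (forall i, convex_function setT (fun x => g i x z)) ->
  forall (l : {i01 R}) (x y : convex_lmodType 'rV[R]_n),
    gmax g (conv l x y) z <= l%:num * gmax g x z + (1 - l%:num) * gmax g y z.
Proof.
move=> cg l x y.
have ci i : g i (conv l x y) z <= l%:num * gmax g x z + (1 - l%:num) * gmax g y z.
  have := cg i l x y; rewrite !in_setE => /(_ I I) /le_trans; apply.
  have l0 : 0 <= l%:num by [].
  have l1 : 0 <= 1 - l%:num by rewrite subr_ge0.
  rewrite convRE.
  by apply: lerD; apply: ler_wpM2l => //; exact: le_gmax.
exact: bigmax_le.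
Qed.

End GMax.

(** * The tail of a mean minimizer along a segment *)

(** Where [a >= eta], the condition on [l] gives [l * - beta <= (1 - l) * a], so the bonus
    [l * - beta] fits even if the maximum is 0; if it is not, the bonus turns [b] into [b - beta].
    Elsewhere [b <= b - beta] suffices. *)
Lemma convex_tail_bound (R : realType) (a b beta eta l : R) :
  0 <= a -> beta <= 0 -> 0 < l < 1 -> l * - beta <= (1 - l) * eta ->
  Num.max (l * b + (1 - l) * a) 0 + l * - beta * (eta <= a)%R%:R <=
    (1 - l) * a + l * Num.max (b - beta) 0.
Proof.
move=> a0 b0 /andP[l0 l1] leta.
have w1 : l * (b - beta) <= l * Num.max (b - beta) 0.
  by rewrite ler_pM2l// le_max lexx.
have w2 : 0 <= l * Num.max (b - beta) 0 by rewrite (mulr_ge0 (ltW l0))// le_max lexx orbT.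
have lb : 0 <= l * - beta by rewrite (mulr_ge0 (ltW l0))// oppr_ge0.
rewrite -lerBrDr ge_max; case: (lerP eta a) => etaa /=.
  have : (1 - l) * eta <= (1 - l) * a by rewrite ler_wpM2l// subr_ge0 ltW.
  by move=> ?; apply/andP; split; nra.
have : 0 <= (1 - l) * a by rewrite mulr_ge0// subr_ge0 ltW.
by move=> ?; apply/andP; split; nra.
Qed.

Lemma ge0_integral_comb d (T : measurableType d) (R : realType)
    (mu : measure T R) (D : set T) (f g : T -> R) (s t : R) :
  measurable D -> measurable_fun D f -> measurable_fun D g ->
  (forall w, 0 <= f w) -> (forall w, 0 <= g w) -> 0 <= s -> 0 <= t ->
  (\int[mu]_(w in D) (s * f w + t * g w)%:E =
   s%:E * \int[mu]_(w in D) (f w)%:E + t%:E * \int[mu]_(w in D) (g w)%:E)%E.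
Proof.
move=> mD mf mg f0 g0 s0 t0.
have posE (h : T -> R) : (forall w, 0 <= h w) -> forall w, D w -> (0 <= (h w)%:E)%E.
  by move=> h0 w _; rewrite lee_fin.
have mfE : measurable_fun D (fun w => (f w)%:E) by exact/measurable_EFinP.
have mgE : measurable_fun D (fun w => (g w)%:E) by exact/measurable_EFinP.
rewrite -(ge0_integralZl_EFin mu mD (posE _ f0) mfE s0).
rewrite -(ge0_integralZl_EFin mu mD (posE _ g0) mgE t0).
rewrite -ge0_integralD//.
- by move=> w _; rewrite -EFinM lee_fin mulr_ge0.
- exact: measurable_funeM.
- by move=> w _; rewrite -EFinM lee_fin mulr_ge0.
- exact: measurable_funeM.
Qed.

(* For a small step [r], moving from [a] to [r b + (1 - r) a] changes the mean
   by at most [r (E[(b - beta)_+] + beta p - E[a])], where [p] is the mass of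
   [{a >= eta}]; if [p > eps], the bound on [b] makes this negative. *)
Lemma mean_minimizer_tail d (T : measurableType d) (R : realType)
    (P : probability T R) (D : set T) (a b : T -> R) (eps : R) :
  measurable D -> measurable_fun D a -> measurable_fun D b ->
  (forall w, 0 <= a w) -> 0 < eps ->
  (\int[P]_(w in D) (a w)%:E < +oo)%E ->
  (forall l : {i01 R},
     (\int[P]_(w in D) (a w)%:E <=
      \int[P]_(w in D) (Num.max (l%:num * b w + (1 - l%:num) * a w) 0)%:E)%E) ->
  (forall e : R, 0 < e -> exists2 beta : R, beta <= 0 &
     (\int[P]_(w in D) (Num.max (b w - beta) 0)%:E <=
        (eps * (e - beta))%:E)%E) ->
  (P (D `&` [set w | (0 < a w)%R]) <= eps%:E)%E.
Proof.
move=> mD ma mb a0 eps0 afin amin cvar.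
(* The sets where [a >= 1 / (n + 1)] increase to the set where [a > 0], so by continuity from below
   it is enough to bound the mass of each. *)
pose E n := D `&` [set w | n.+1%:R^-1 <= a w].
have mE n : measurable (E n) by exact: measurable_fun_le.
have UE : \bigcup_n E n = D `&` [set w | 0 < a w].
  apply/seteqP; split=> [w [n _ [Dw /= na]]|w [Dw /= aw]].
    by split=> //=; apply: lt_le_trans na; rewrite invr_gt0.
  have [N _ /(_ N (leqnn N)) aN] := near_infty_natSinv_lt (PosNum aw).
  by exists N => //; split=> //=; exact: ltW.
suff PE n : (P (E n) <= eps%:E)%E.
  rewrite -UE.
  have PU : P \o E @ \oo --> P (\bigcup_n E n).
    apply: nondecreasing_cvg_mu => //; first exact: bigcup_measurable.
    move=> i j ij; apply/subsetPset => w [Dw /= iw]; split=> //=.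
    by apply: le_trans iw; rewrite lef_pV2 ?posrE// ler_nat.
  rewrite -(cvg_lim _ PU)//; apply: lime_le; first exact: cvgP PU.
  by apply: nearW => n; exact: PE.
rewrite leNgt; apply/negP => epsp.
set eta : R := n.+1%:R^-1.
have eta0 : 0 < eta by rewrite invr_gt0.
have [beta beta0 Wle] := cvar _ eta0.
(* The step [eta / (eta - beta + 1)] satisfies [r * (eta - beta) <= eta], which is the condition of
   [convex_tail_bound]; the added 1 keeps it below 1 when [beta = 0]. *)
have e1 : 0 < eta - beta + 1 by lra.
have l0 : 0 < eta / (eta - beta + 1) by rewrite divr_gt0.
have l1 : eta / (eta - beta + 1) < 1 by rewrite ltr_pdivrMr//; lra.
have le1 : eta / (eta - beta + 1) * (eta - beta) <= eta.
  by rewrite mulrAC ler_pdivrMr// ler_pM2l//; lra.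
pose l := Itv01 (ltW l0) (ltW l1).
have {}amin := amin l; rewrite /= in amin.
set r : R := eta / _ in l0 l1 le1 l amin.
have maE : measurable_fun D (EFin \o a) by exact/measurable_EFinP.
have mw : measurable_fun D (fun w => Num.max (b w - beta) 0).
  by apply: measurable_maxr => //; exact: measurable_funB.
have mc : measurable_fun D (fun w => Num.max (r * b w + (1 - r) * a w) 0).
  by apply: measurable_maxr => //; apply: measurable_funD; exact: measurable_funM.
have mi : measurable_fun D (\1_(E n) : T -> R) by exact: measurable_indic.
have iE w : D w -> (eta <= a w)%R%:R = \1_(E n) w :> R.
  move=> Dw; rewrite indicE; congr (_%:R); congr nat_of_bool.
  by apply/idP/idP => [?|]; [rewrite inE; split|rewrite inE => -[]].
have pE : (\int[P]_(w in D) (\1_(E n) w)%:E)%E = P (E n).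
  by rewrite integral_indic// setIidl// => w [].
have r0 : 0 <= r * - beta by rewrite (mulr_ge0 (ltW l0))// oppr_ge0.
have r1 : 0 <= 1 - r by rewrite subr_ge0 ltW.
(* Integrated form of [convex_tail_bound]. *)
have h1 : (\int[P]_(w in D) (Num.max (r * b w + (1 - r) * a w) 0)%:E +
    (r * - beta)%:E * P (E n) <= (1 - r)%:E * \int[P]_(w in D) (a w)%:E +
    r%:E * \int[P]_(w in D) (Num.max (b w - beta) 0)%:E)%E.
  have max0 (x : R) : 0 <= Num.max x 0 by rewrite le_max lexx orbT.
  rewrite -pE -ge0_integral_comb// ?(ltW l0)// -[X in (X + _)%E]mul1e.
  rewrite -ge0_integral_comb//.
  apply: ge0_le_integral => //.
  - by move=> w _; rewrite lee_fin addr_ge0// mulr_ge0.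
  - apply/measurable_EFinP; apply: measurable_funD; exact: measurable_funM.
  - apply/measurable_EFinP; apply: measurable_funD; exact: measurable_funM.
  - move=> w Dw; rewrite lee_fin mul1r -iE//; apply: convex_tail_bound => //.
      by rewrite l0 l1.
    by lra.
(* Markov's inequality; the zero multiple of the integral of [a] only gives the left side the shape
   of [ge0_integral_comb]. *)
have h2 : (eta%:E * P (E n) <= \int[P]_(w in D) (a w)%:E)%E.
  have -> : (eta%:E * P (E n) = 0%:E * \int[P]_(w in D) (a w)%:E + eta%:E * P (E n))%E.
    by rewrite mul0e add0e.
  rewrite -pE -ge0_integral_comb// ?(ltW eta0)//.
  apply: ge0_le_integral => //.
  - by move=> w _; rewrite lee_fin addr_ge0// mulr_ge0 ?(ltW eta0).
  - apply/measurable_EFinP; apply: measurable_funD; exact: measurable_funM.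
  - move=> w Dw; rewrite lee_fin mul0r add0r -iE//.
    by case: (lerP eta (a w)) => /=; rewrite ?mulr1// mulr0.
have int0 (f : T -> R) : (forall w, 0 <= f w) -> (0 <= \int[P]_(w in D) (f w)%:E)%E.
  by move=> f0; apply: integral_ge0 => w _; rewrite lee_fin.
have Afin : (\int[P]_(w in D) (a w)%:E)%E \is a fin_num.
  by rewrite ge0_fin_numE ?(int0 _ a0).
have Wfin : (\int[P]_(w in D) (Num.max (b w - beta) 0)%:E)%E \is a fin_num.
  rewrite ge0_fin_numE; first exact: le_lt_trans Wle (ltry _).
  by apply: int0 => w; rewrite le_max lexx orbT.
have pfin : P (E n) \is a fin_num by exact: fin_num_measure.
move: h1 h2 Wle epsp amin.
rewrite -(fineK Afin) -(fineK Wfin) -(fineK pfin).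
set A := fine (\int[P]_(w in D) (a w)%:E); set p := fine (P _).
set W := fine _; move=> h1 + + + amin.
have {}h1 := le_trans (leeD2r _ amin) h1.
move: h1; rewrite -!EFinM -!EFinD !lee_fin !lte_fin => h1 h2 Wle epsp.
(* Minimality has put [A] in place of the mean after the step; cancelling [(1 - r) * A], which is
   finite, and dividing by [r] removes the step size. With [W <= eps * (eta - beta)] and [eps < p]
   this contradicts [eta * p <= A]. *)
have h3 : A + - beta * p <= W by rewrite -(ler_pM2l l0); lra.
have h4 : eta * eps < eta * p by rewrite ltr_pM2l.
have h5 : - beta * eps <= - beta * p by rewrite ler_wpM2l ?oppr_ge0// ltW.
by lra.
Qed.

(** * Reduction of the lower-level problem to [x] alone, and its link with CVaR *)

Lemma measurable_closed_borelRn (R : realType) (m : nat) (A : set 'rV[R]_m) :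
  closed A -> measurable (A : set (borelRn R m)).
Proof.
move=> cA; rewrite -[A]setCK; apply: measurableC.
by apply: sub_sigma_algebra; exact: closed_openC.
Qed.

Lemma almost_surely_forall d (T : measurableType d) (R : realType)
    (P : probability T R) (m : nat) (xi : {RV P >-> borelRn R m})
    (Xi : set 'rV[R]_m) (I : finType) (Q : I -> 'rV[R]_m -> Prop) :
  (forall i, almost_surely xi Xi (Q i)) ->
  almost_surely xi Xi (fun z => forall i, Q i z).
Proof.
rewrite /almost_surely => aeQ.
have : \forall w \near almost_everywhere P, forall i, Xi (xi w) -> Q i (xi w).
  exact: filter_forall.
by apply: filterS => w Qw Dw i; exact: Qw.
Qed.

Section LowerLevel.
Context {d : measure_display} {T : measurableType d} {R : realType}.
Context (P : probability T R) {m : nat} (xi : {RV P >-> borelRn R m}).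
Context (Xi : set 'rV[R]_m) {n : nat} (c : 'rV[R]_n) (X : set 'rV[R]_n).
Context (G : 'rV[R]_n -> 'rV[R]_m -> R).

Local Notation D := (xi @^-1` Xi).

(** The least [s] admissible for a given [x], up to null sets: the lower level amounts to minimizing
    its mean over [x]. *)
Definition shortfall (x : 'rV[R]_n) (z : 'rV[R]_m) : R := Num.max (G x z) 0.

Context (Xi_closed : closed Xi).
Context (mG : forall x, measurable_fun (Xi : set (borelRn R m)) (G x)).

Lemma shortfall_ge0 x z : 0 <= shortfall x z.
Proof. by rewrite le_max lexx orbT. Qed.

Lemma measurable_support_preimage : measurable D.
Proof.
rewrite -[D]setTI; apply: (@measurable_funP _ _ _ _ setT xi) => //.
exact: measurable_closed_borelRn.
Qed.

Lemma measurable_fun_comp_support (s : 'rV[R]_m -> R) :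
  measurable_fun (Xi : set (borelRn R m)) s -> measurable_fun D (s \o xi).
Proof.
move=> ms; apply: (measurable_comp (F := (Xi : set (borelRn R m)))) => //.
- exact: measurable_closed_borelRn.
- by move=> _ [w Dw <-].
- by apply: measurable_funTS; exact: measurable_funP.
Qed.

Lemma measurable_shortfall x :
  measurable_fun (Xi : set (borelRn R m)) (shortfall x).
Proof. by apply: measurable_maxr. Qed.

Lemma shortfall_lower_feasible t x : X x -> dotp c x <= t ->
  lower_feasible xi Xi c X G t x (shortfall x).
Proof.
move=> Xx cxt; split => //.
- exact: measurable_shortfall.
- by apply: aeW => w _; exact: shortfall_ge0.
- by apply: aeW => w _; rewrite le_max lexx.
Qed.

Lemma shortfall_le_Exp t x s : lower_feasible xi Xi c X G t x s ->
  (Exp xi Xi (shortfall x) <= Exp xi Xi s)%E.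
Proof.
rewrite /lower_feasible /almost_surely => -[Xx ms s0 Gs cxt].
have mD := measurable_support_preimage.
have mE (h : 'rV[R]_m -> R) : measurable_fun (Xi : set (borelRn R m)) h ->
    measurable_fun D (fun w => (h (xi w))%:E).
  by move=> mh; apply/measurable_EFinP; exact: measurable_fun_comp_support.
have msp : measurable_fun (Xi : set (borelRn R m)) (fun z => Num.max (s z) 0).
  exact: measurable_maxr.
(* [s] is nonnegative only almost surely, whereas the comparison of integrals used below asks for
   nonnegativity everywhere. *)
have -> : Exp xi Xi s = Exp xi Xi (fun z => Num.max (s z) 0).
  apply: ae_eq_integral => //; [exact: (mE _ ms)|exact: (mE _ msp)|].
  by rewrite /ae_eq; move: s0; apply: filterS => w s0w /s0w ?; rewrite max_l.
rewrite /Exp; apply: ae_ge0_le_integral => //.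
- by move=> w _; rewrite lee_fin shortfall_ge0.
- exact: (mE _ (measurable_shortfall x)).
- by move=> w _; rewrite lee_fin le_max lexx orbT.
- exact: (mE _ msp).
- apply: filterS Gs => w Gsw /Gsw Gw.
  by rewrite lee_fin ge_max !le_max Gw lexx orbT.
Qed.

Lemma lower_argmin_shortfall t x : X x -> dotp c x <= t ->
  (Exp xi Xi (shortfall x) < +oo)%E ->
  (forall y, X y -> dotp c y <= t ->
     (Exp xi Xi (shortfall x) <= Exp xi Xi (shortfall y))%E) ->
  lower_argmin xi Xi c X G t x (shortfall x).
Proof.
move=> Xx cxt xfin xmin; split=> //; first exact: shortfall_lower_feasible.
move=> y s ys; apply: le_trans (shortfall_le_Exp ys).
by case: ys => Xy _ _ _ cyt; exact: xmin.
Qed.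

(** In a minimizing pair, replacing [s] by the shortfall of the same [x] keeps feasibility and does
    not raise the mean. *)
Lemma attained_lower_argmin_shortfall t : lower_attained xi Xi c X G t ->
  (exists x, [/\ X x, dotp c x <= t & (Exp xi Xi (shortfall x) < +oo)%E]) ->
  exists x, lower_argmin xi Xi c X G t x (shortfall x).
Proof.
move=> att [x0 [Xx0 cx0 x0fin]].
have [|x [s [xs sfin smin]]] := att.
  by exists x0, (shortfall x0); split=> //; exact: shortfall_lower_feasible.
have xles := shortfall_le_Exp xs; have [Xx _ _ _ cxt] := xs.
exists x; apply: lower_argmin_shortfall => //; first exact: le_lt_trans sfin.
move=> y Xy cyt; apply: (le_trans xles); apply: smin (y) _ _.
exact: shortfall_lower_feasible.
Qed.

Lemma compact_lower_argmin_shortfall t :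
  compact (X `&` [set x | dotp c x <= t]) ->
  almost_surely xi Xi (fun z => lower_semicontinuous (fun x => (shortfall x z)%:E)) ->
  (exists x, [/\ X x, dotp c x <= t & (Exp xi Xi (shortfall x) < +oo)%E]) ->
  exists x, lower_argmin xi Xi c X G t x (shortfall x).
Proof.
move=> cK lscG [x0 [Xx0 cx0 x0fin]].
have [||||x [Xx cxt] xmin] := integral_lsc_attains_min (mu := P) (D := D)
    (f := fun x w => shortfall x (xi w)) measurable_support_preimage cK.
- by exists x0.
- by move=> *; exact: shortfall_ge0.
- by move=> x; apply: measurable_fun_comp_support; exact: measurable_shortfall.
- exact: lscG.
exists x; apply: lower_argmin_shortfall => //; last by move=> y Xy cyt; exact: xmin.
exact: le_lt_trans (xmin _ (conj Xx0 cx0)) x0fin.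
Qed.

Lemma cvar_term_lt (eps b e : R) x : 0 < eps -> (cvar_term xi Xi eps G x b < e%:E)%E ->
  (Exp xi Xi (fun z => Num.max (G x z - b) 0)%R <= (eps * (e - b))%:E)%E.
Proof.
move=> eps0; rewrite /cvar_term.
have : (0 <= Exp xi Xi (fun z => Num.max (G x z - b) 0)%R)%E.
  by rewrite /Exp; apply: integral_ge0 => w _; rewrite lee_fin le_max lexx orbT.
case: (Exp _ _ _) => [r _|_|//]; last first.
  by rewrite gt0_muley ?lte_fin ?invr_gt0// addey.
rewrite -EFinM -EFinD lte_fin lee_fin addrC -ltrBrDr => /ltW.
by rewrite -ler_pdivrMl// mulrC.
Qed.

(** The slack [e] is there because the infimum over [b] is not assumed to be attained. *)
Lemma cvar_feasible_lt (eps : R) x : 0 < eps -> cvar_feasible xi Xi eps X G x ->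
  forall e : R, 0 < e -> exists2 b : R, b <= 0 &
    (Exp xi Xi (fun z => Num.max (G x z - b) 0)%R <= (eps * (e - b))%:E)%E.
Proof.
move=> eps0 [_ infle] e e0.
have e0E : (0 < e%:E)%E by rewrite lte_fin.
have [_ [b b0 <-] be] := ereal_inf_lt (le_lt_trans infle e0E).
by exists b => //; exact: cvar_term_lt be.
Qed.

(** For [b <= 0] the shortfall is at most the positive part of [G x z - b], whose mean is finite for
    a suitable [b]. *)
Lemma cvar_feasible_shortfall_lty (eps : R) x : 0 < eps ->
  cvar_feasible xi Xi eps X G x -> (Exp xi Xi (shortfall x) < +oo)%E.
Proof.
move=> eps0 /(cvar_feasible_lt eps0)/(_ 1 ltr01)[b b0 bfin].
apply: le_lt_trans (le_lt_trans bfin (ltry _)).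
have mD := measurable_support_preimage.
rewrite /Exp; apply: ge0_le_integral => //.
- by move=> w _; rewrite lee_fin shortfall_ge0.
- apply/measurable_EFinP; apply: measurable_fun_comp_support.
  exact: measurable_shortfall.
- apply/measurable_EFinP; apply: (measurable_fun_comp_support
    (s := fun z => Num.max (G x z - b) 0)).
  by apply: measurable_maxr => //; exact: measurable_funB.
- move=> w _; rewrite lee_fin ge_max !le_max lexx orbT andbT.
  by rewrite lerBrDr gerDl b0.
Qed.

(** [mean_minimizer_tail] applies with [a] the shortfall of [y] and [b] the value of [G x]: the
    segment from [y] to [x] stays feasible, so minimality of [y] can be tested along it. *)
Lemma lower_argmin_shortfall_chance (eps : R) t x y : 0 < eps -> P D = 1%E ->
  convex_set X ->
  almost_surely xi Xi (fun z => forall (l : {i01 R}) (x y : convex_lmodType 'rV[R]_n),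
    G (conv l x y) z <= l%:num * G x z + (1 - l%:num) * G y z) ->
  lower_argmin xi Xi c X G t y (shortfall y) ->
  cvar_feasible xi Xi eps X G x -> dotp c x <= t ->
  ((1 - eps)%:E <= Pr xi Xi [set z | shortfall y z = 0%R])%E.
Proof.
move=> eps0 PD Xconv Gconv [[Xy _ _ _ cyt] yfin ymin] xcvar cxt.
have mD := measurable_support_preimage.
have ma : measurable_fun D (shortfall y \o xi).
  by apply: measurable_fun_comp_support; exact: measurable_shortfall.
have mb : measurable_fun D (G x \o xi) by exact: measurable_fun_comp_support.
have tail : (P (D `&` [set w | (0 < shortfall y (xi w))%R]) <= eps%:E)%E.
  apply: (mean_minimizer_tail mD ma mb) => //.
  - by move=> w; exact: shortfall_ge0.
  - move=> l; have Xl : X (conv l (x : convex_lmodType _) y).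
      by apply/set_mem; apply: Xconv; apply/mem_set => //; case: xcvar.
    have cl : dotp c (conv l (x : convex_lmodType _) y) <= t.
      rewrite dotpDr !dotpZr.
      have l0 : 0 <= l%:num by [].
      have l1 : 0 <= 1 - l%:num by rewrite subr_ge0.
      have -> : t = l%:num * t + (1 - l%:num) * t by ring.
      by apply: lerD; apply: ler_wpM2l.
    apply: le_trans (ymin _ _ (shortfall_lower_feasible Xl cl)) _.
    rewrite /Exp; apply: ae_ge0_le_integral => //.
    + by move=> w _; rewrite lee_fin shortfall_ge0.
    + apply/measurable_EFinP; apply: measurable_fun_comp_support.
      exact: measurable_shortfall.
    + by move=> w _; rewrite lee_fin le_max lexx orbT.
    + apply/measurable_EFinP; apply: measurable_maxr => //.
      by apply: measurable_funD; exact: measurable_funM.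
    + move: Gconv; rewrite /almost_surely; apply: filterS => w Gw /Gw/(_ l x y) Gl.
      rewrite lee_fin ge_max !le_max lexx orbT andbT; apply/orP; left.
      apply: (le_trans Gl); rewrite lerD2l ler_wpM2l//.
      by rewrite le_max lexx.
  - exact: cvar_feasible_lt xcvar.
have mpos : measurable (D `&` [set w | (0 < shortfall y (xi w))%R]).
  have m0 : measurable_fun D (fun=> 0 : R) by exact: measurable_cst.
  rewrite -[X in measurable X]/(D `&` (fun w => 0 < shortfall y (xi w)) @^-1` [set true]).
  exact: (measurable_fun_ltr m0 ma).
(* A nonnegative shortfall vanishes exactly where it is not positive, so the tail bound passes to
   the complement within [D], which has mass 1. *)
have -> : Pr xi Xi [set z | shortfall y z = 0] =
    P (D `\` (D `&` [set w | (0 < shortfall y (xi w))%R])).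
  rewrite /Pr; congr (P _); apply/seteqP; split=> w /=.
    by move=> [Dw aw]; split=> // -[_]; rewrite aw ltxx.
  move=> [Dw naw]; split=> //; apply/eqP; rewrite eq_le shortfall_ge0 andbT.
  by rewrite leNgt; apply/negP => aw; apply: naw.
have Dfin : (P D < +oo)%E by rewrite PD ltry.
by rewrite measureD// setIA setIid [X in (_ <= X - _)%E]PD EFinB leeB.
Qed.

End LowerLevel.

Theorem theorem1 (d : measure_display) (T : measurableType d) (R : realType)
  (P : probability T R) (n m k : nat)
  (xi : {RV P >-> borelRn R m}) (Xi : set 'rV[R]_m) (hXi : is_support xi Xi)
  (eps : R) (heps : 0 < eps < 1) (c : 'rV[R]_n)
  (g : 'I_k.+1 -> 'rV[R]_n -> 'rV[R]_m -> R)
  (hgmeas : forall i x, measurable_fun (Xi : set (borelRn R m)) (g i x))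
  (hgconv : forall i, almost_surely xi Xi (fun z =>
     convex_function setT (fun x => g i x z)))
  (hglsc : forall i, almost_surely xi Xi (fun z =>
     lower_semicontinuous (fun x => (g i x z)%:E)))
  (X C : set 'rV[R]_n)
  (hX0 : X !=set0) (hXclosed : closed X) (hXconv : convex_set X)
  (hC : closed_pointed_convex_cone C) (hXC : X `<=` C)
  (hfeas : ccp_feasible xi Xi eps X (gmax g) !=set0)
  (hc : (interior (dual_cone C) `|` [set 0]) c)
  (* For c = 0 the set X `&` [set x | dotp c x <= t] need not be bounded and the
     lower-level argmin may be empty; its attainment is presupposed there. *)
  (hatt : c = 0 -> forall t : R, lower_attained xi Xi c X (gmax g) t) :
  (alsox_value xi Xi eps c X (gmax g) <= cvar_value xi Xi eps c X (gmax g))%E.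
Proof.
have [eps0 _] := andP heps; have [Xi_cl PXi _] := hXi.
have mG x : measurable_fun (Xi : set (borelRn R m)) (gmax g x).
  by apply: measurable_gmax => i; exact: hgmeas.
have Gconv : almost_surely xi Xi (fun z =>
    forall (l : {i01 R}) (x y : convex_lmodType 'rV[R]_n),
    gmax g (conv l x y) z <=
      l%:num * gmax g x z + (1 - l%:num) * gmax g y z).
  have := almost_surely_forall hgconv; rewrite /almost_surely.
  by apply: filterS => w gw /gw; exact: gmax_convex.
apply: le_ereal_inf_tmp => _ [x xcvar <-].
(* Each CVaR-feasible [x] yields the ALSO-X-feasible level [t = dotp c x]. *)
apply: ereal_inf_lbound; exists (dotp c x) => //.
have xfin : exists y, [/\ X y, dotp c y <= dotp c x &
    (Exp xi Xi (shortfall (gmax g) y) < +oo)%E].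
  exists x; split=> //; first by case: xcvar.
  exact: cvar_feasible_shortfall_lty xcvar.
have [y ymin] : exists y, lower_argmin xi Xi c X (gmax g) (dotp c x) y
    (shortfall (gmax g) y).
  (* For [c = 0] attainment is the hypothesis [hatt]; for [c] interior to the dual cone it comes
     from compactness and semicontinuity. *)
  case: hc => [cint|c0]; last first.
    by apply: attained_lower_argmin_shortfall => //; exact: hatt.
  apply: compact_lower_argmin_shortfall => //; first exact: compact_sublevel cint.
  have := almost_surely_forall hglsc; rewrite /almost_surely.
  by apply: filterS => w gw /gw; exact: lower_semicontinuous_gmax_pos.
exists y, (shortfall (gmax g) y); split=> //.
exact: (lower_argmin_shortfall_chance Xi_cl mG eps0 PXi hXconv Gconv ymin xcvar).
Qed.
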